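(* Let $n$ be a positive integer and consider the group $\mathbb{Z}/n\mathbb{Z}$ under addition. The saturated subsets of $\mathbb{Z}/n\mathbb{Z}$ are: (a) if $n=2k+1$: the sets $\{a,b\}$ with $a\neq b$; (b) if $n=4k+2$: the sets $\{a,a+x,a+2x\}$ with $x$ odd, $x\neq n/2$, and $a$ even; the sets $\{a,a+n/2\}$; and, if $k>0$, the set $\{x \mid x=2l+1,\ 1\le l\le n/2\}$ of all odd elements; (c) if $n=4k$: the sets $\{a,a+x,a+2x\}$ with $x$ odd and $a$ even; the sets $\{a,a+4x\}$ with $a$ even and $x\neq n/4$; and the set $\{x \mid x=2l+1,\ 1\le l\le n/2\}$ of all odd elements.
   Context: For a set $S$ with a binary operation, a subset $U\subseteq S$ is avoidable if there is a partition $\{A,B\}$ of $S$ such that no element of $U$ is the product of two distinct elements of $A$ or of two distinct elements of $B$. A subset is saturated if it is maximal with respect to inclusion among the avoidable subsets of $S$. In an abelian group (written additively), an element $b$ is called even if there exists $x$ with $2x=b$, and odd otherwise.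
   Formalization: In (c), the sets {a, a+4x} are also required to satisfy 4x ≠ 0; without this, x = 0 (for example n = 4, a = 0) would list the singleton {0}, which is not saturated since it lies in the avoidable set {0,1,2}. *)

(* Defs.v *)
From mathcomp Require Import all_boot all_algebra.

Set Implicit Arguments.
Unset Strict Implicit.
Unset Printing Implicit Defensive.

Import GRing.Theory.
Local Open Scope ring_scope.

Definition sum_avoiding (T : finType) (op : T -> T -> T) (U A : {set T}) : bool :=
  [forall x in A, forall y in A, (x != y) ==> (op x y \notin U)].

(* Since [partition] requires nonempty blocks and [A != B] rules out the
   one-block partition [[set A; A]], A and B are two nonempty disjoint sets
   covering T. Allowing an empty block would only matter when #|T| <= 1: on the
   trivial group the full set would then be avoidable, whereas the convention
   used here makes no set avoidable. *)
Definition avoidable (T : finType) (op : T -> T -> T) (U : {set T}) : bool :=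
  [exists A : {set T}, exists B : {set T},
    [&& A != B, partition [set A; B] [set: T],
        sum_avoiding op U A & sum_avoiding op U B]].

Definition saturated (T : finType) (op : T -> T -> T) (U : {set T}) : bool :=
  maxset (avoidable op) U.

Definition even_elt (G : finZmodType) (b : G) : bool := [exists x : G, x *+ 2 == b].

Definition odd_elt (G : finZmodType) (b : G) : bool := ~~ even_elt b.

(* The group Z/nZ with n = m.+1 is the canonical Z-module 'I_m.+1, for which
   [inZp : nat -> 'I_m.+1] is the reduction modulo n. *)
Definition odd_residues (m : nat) : {set 'I_m.+1} :=
  [set inZp (2 * l + 1) | l : 'I_m.+1 & (1 <= l <= m.+1 %/ 2)%N].

(* Main.v *)
(* A set U is avoidable iff the graph joining x to y when x + y lies in U is
   bipartite. Each u in U contributes the edges of the involution y |-> u - y.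
   Two involutions always give a bipartite graph, so all pairs are avoidable;
   reflection in a + 2x is the reflection in a conjugated by the reflection in
   a + x, so progressions a, a + x, a + 2x with a + x odd are avoidable too.
   Conversely three distinct elements of U with even sum produce a triangle,
   and two even elements with an odd one that is not their midpoint produce a
   closed walk of length five. *)
Require Import Defs.
From mathcomp Require Import all_boot all_algebra.
Import GRing.Theory.
Local Open Scope ring_scope.

(** * Avoidability as two-colourability *)

Lemma avoidable_card_gt1 (T : finType) (op : T -> T -> T) (U : {set T}) :
  avoidable op U -> (1 < #|T|)%N.
Proof.
case/existsP=> A /existsP[B /and4P[neAB /and3P[_ /trivIsetP triv AB0] _ _]].
have [A0 B0] : A != set0 /\ B != set0.
  by split; apply: contraNneq AB0 => <-; rewrite ?set21 ?set22.
case/set0Pn: A0 => a aA; case/set0Pn: B0 => b bB.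
have dAB := triv A B (set21 A B) (set22 A B) neAB.
apply/card_gt1P; exists a, b; split=> //.
by apply: contraTneq bB => <-; rewrite (disjointFr dAB).
Qed.

(** The two blocks are the colour classes. A colouring may be constant whereas blocks are nonempty;
    having two elements in [T] bridges this gap. *)
Lemma avoidableP (T : finType) (op : T -> T -> T) (U : {set T}) :
  (1 < #|T|)%N ->
  reflect (exists c : T -> bool,
             forall x y, x != y -> op x y \in U -> c x != c y)
          (avoidable op U).
Proof.
move=> T_gt1; apply: (iffP existsP) => [[A /existsP[B]]|[c cU]].
  case/and4P=> neAB /and3P[/eqP covAB triv _] /forallP avA /forallP avB.
  exists (mem A) => x y nexy xyU.
  have inAB z : (z \in A) || (z \in B).
    by have := in_setT z; rewrite -covAB /cover bigcup_setU !big_set1 inE.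
  have avoid (C : {set T}) : (forall z, (z \in C) ==> [forall w in C, (z != w) ==> (op z w \notin U)]) ->
      x \in C -> y \notin C.
    move=> avC xC; apply/negP=> yC; have := avC x; rewrite xC /=.
    by move/forallP/(_ y); rewrite yC nexy xyU.
  have [xA|xA] := boolP (x \in A); first by rewrite /= xA (negPf (avoid _ avA xA)).
  have xB : x \in B by have := inAB x; rewrite (negPf xA).
  have := inAB y; rewrite (negPf (avoid _ avB xB)) orbF /= (negPf xA).
  by move->.
have /card_gt1P[a [b [_ _ neab]]] := T_gt1.
wlog [x0 [y0 [cx cy]]] : c cU / exists x0 y0, c x0 /\ ~~ c y0.
  (* If [c] is constant then no constraint is active, and any colouring works. *)
  move=> IH; have constant d : (forall z, c z = d) -> exists A : {set T},
      [exists B : {set T}, [&& A != B, partition [set A; B] [set: T],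
        sum_avoiding op U A & sum_avoiding op U B]].
    move=> cd; apply: (IH (pred1 a)).
      by move=> x y nexy /(cU x y nexy); rewrite !cd eqxx.
    by exists a, b; rewrite /= eqxx eq_sym.
  have [/existsP[z cz]|/existsPn nocT] := boolP [exists z, c z]; last first.
    by apply: (constant false) => z; apply/negbTE/nocT.
  have [/existsP[w cw]|/existsPn nocF] := boolP [exists w, ~~ c w]; last first.
    by apply: (constant true) => w; apply/negbNE/nocF.
  by apply: (IH c cU); exists z, w.
have disj : [disjoint [set z | c z] & [set z | ~~ c z]].
  by rewrite -setI_eq0; apply/eqP/setP=> z; rewrite !inE andbN.
have neAB : [set z | c z] != [set z | ~~ c z].
  by apply/eqP=> /setP/(_ x0); rewrite !inE cx.
exists [set z | c z]; apply/existsP; exists [set z | ~~ c z].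
apply/and4P; split=> //.
- apply/and3P; split.
  + rewrite /cover bigcup_setU !big_set1.
    by apply/eqP/setP=> z; rewrite !inE orbN.
  + apply/trivIsetP=> C D; rewrite !inE.
    case/orP=> /eqP-> /orP[]/eqP->; rewrite ?eqxx //.
    by rewrite disjoint_sym.
  + rewrite !inE negb_or; apply/andP; split; apply/eqP=> /setP.
      by move/(_ x0); rewrite !inE cx.
    by move/(_ y0); rewrite !inE cy.
- apply/forall_inP=> x; rewrite inE => cx'; apply/forall_inP=> y; rewrite inE => cy'.
  apply/implyP=> nexy; apply/negP=> /(cU x y nexy).
  by rewrite cx' cy'.
- apply/forall_inP=> x; rewrite inE => cx'; apply/forall_inP=> y; rewrite inE => cy'.
  apply/implyP=> nexy; apply/negP=> /(cU x y nexy).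
  by rewrite (negPf cx') (negPf cy').
Qed.

(** * Bipartiteness of the graph of two involutions *)

Section TwoInvolutions.

Context {T : finType} (f : bool -> T -> T) (fK : forall i, involutive (f i)).

Fixpoint alternate (i : bool) (k : nat) (x : T) : T :=
  if k is j.+1 then f (i (+) odd j) (alternate i j x) else x.

(* If an alternating walk of odd length closes up, it is a palindrome, so its
   middle step is stationary. *)
Lemma alternate_odd_closed i k x :
  odd k -> alternate i k x = x ->
  exists2 j, (j < k)%N & alternate i j.+1 x = alternate i j x.
Proof.
move=> odd_k closed.
(* Since [k] is odd, steps [j] and [k - j.+1] apply the same involution, so the walks from the two
   ends keep agreeing. *)
have palin j : (j <= k)%N -> alternate i (k - j) x = alternate i j x.
  elim: j => [|j IHj] jk; first by rewrite subn0.
  have := IHj (ltnW jk); rewrite -[(k - j)%N]prednK ?subn_gt0 // -subnS /=.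
  rewrite oddB // odd_k /= negbK => <-.
  by rewrite fK.
have kE : k = (k./2 + k./2).+1 by rewrite -[LHS]odd_double_half odd_k addnn.
have lt_half : (k./2 < k)%N by rewrite [X in (_ < X)%N]kE ltnS leq_addr.
exists k./2 => //; rewrite -palin //; congr (alternate i _ x).
by rewrite [X in (X - _)%N]kE subSS addnK.
Qed.

(** Adjacency in the bipartite double cover. Fixed points give no edge, since a colouring is not
    constrained there. *)
Let step : rel (T * bool) :=
  fun u v => [&& u.1 != v.1, v.2 == ~~ u.2 & (v.1 == f false u.1) || (v.1 == f true u.1)].

Let step_sym : connect_sym step.
Proof.
apply: sym_connect_sym => -[x b] [y c]; rewrite /step /= eq_sym.
rewrite ![_ == f _ y]eq_sym !(inv_eq (fK _)).
by case: b; case: c.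
Qed.

(** A path between the two lifts of [x] projects to a closed walk of odd length. Once backtracking
    is removed it alternates between the involutions, so one of its steps would be stationary. *)
Let odd_walk_open x : ~~ connect step (x, false) (x, true).
Proof.
pose reach u := exists i k, [/\ alternate i k x = u.1, odd k = u.2
  & forall j, (j < k)%N -> alternate i j.+1 x != alternate i j x].
have reach_step u v : reach u -> step u v -> reach v.
  case: u v => [y b] [z c] [i [k [/= yE bE moves]]] /and3P[/= neyz /eqP-> zE].
  have {zE} [l zE] : exists l, z = f l y.
    by case/orP: zE => /eqP->; [exists false | exists true].
  have forward : z = f (i (+) odd k) y -> reach (z, ~~ b).
    move=> zE'; exists i, k.+1; rewrite /= yE zE' bE; split=> // j.
    rewrite ltnS leq_eqVlt => /orP[/eqP->|/moves//].
    by rewrite /= yE -zE' eq_sym.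
  have [lE|lE] := eqVneq l (i (+) odd k); first by apply: forward; rewrite zE lE.
  (* Repeating the last involution cancels the last step and shortens the walk; from the empty walk
     it just starts with the other involution. *)
  case: k lE yE bE moves {forward} => [|k] lE /= yE bE moves.
    exists l, 1%N; rewrite -bE /= addbF zE -yE; split=> // -[] //= _.
    by rewrite addbF yE -zE eq_sym.
  have {}lE : l = i (+) odd k by case: l i {zE yE moves} lE => -[] /=; case: odd.
  exists i, k; rewrite -bE /= negbK; split=> // [|j jk]; last exact/moves/ltnW.
  by rewrite zE -yE lE /= fK.
apply/negP=> /connectP[p p_step p_last].
have : reach (last (x, false) p).
  have : reach (x, false) by exists false, 0%N.
  by elim: p (x, false) p_step {p_last} => //= v p IHp u /andP[/reach_step uv /IHp pv] /uv.
rewrite -p_last => -[i [k [/= closed odd_k moves]]].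
by have [j /moves/eqP] := alternate_odd_closed i k x odd_k closed.
Qed.

(* Vertices are compared through the components of the bipartite double cover:
   the two lifts of a vertex never share a component. *)
Lemma involutions_bicolouring :
  exists c : T -> bool, forall i x, x != f i x -> c x != c (f i x).
Proof.
exists (fun x => enum_rank (fingraph.root step (x, false)) < enum_rank (fingraph.root step (x, true)))%N.
move=> i x ne.
(* Along an edge the two lifts exchange components, which reverses the comparison of ranks. *)
have lift b : fingraph.root step (x, b) = fingraph.root step (f i x, ~~ b).
  apply/(fingraph.rootP step_sym)/connect1; rewrite /step /= ne eqxx /=.
  by case: i {ne}; rewrite eqxx ?orbT.
rewrite !lift /=; set r1 := fingraph.root _ _; set r2 := fingraph.root _ _.
have : (enum_rank r1 != enum_rank r2 :> nat).
  rewrite (inj_eq val_inj) (inj_eq enum_rank_inj).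
  by rewrite eq_sym; apply: contra (odd_walk_open (f i x)) => /eqP/(fingraph.rootP step_sym).
by case: ltngtP.
Qed.

End TwoInvolutions.

(** * Sum graphs of finite abelian groups *)

Section AbelianGroup.

Variable G : finZmodType.
Hypothesis G_gt1 : (1 < #|G|)%N.
Implicit Types (a b x : G) (U : {set G}).

(** Each [x] is joined to its reflections [a - x] and [b - x], and reflections are involutions. *)
Lemma pair_bicolouring a b :
  exists c : G -> bool, forall x u, u \in [set a; b] -> x != u - x -> c x != c (u - x).
Proof.
have [|c cP] := involutions_bicolouring (fun (i : bool) (x : G) => (if i then b else a) - x).
  by move=> i x; rewrite subKr.
exists c => x u; rewrite !inE => /orP[]/eqP->; [exact: (cP false) | exact: (cP true)].
Qed.

Lemma pair_avoidable a b : avoidable +%R [set a; b].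
Proof.
have [c cP] := pair_bicolouring a b; apply/(avoidableP _ _ _ G_gt1).
by exists c => x y nexy /(cP x); rewrite addrAC subrr add0r; exact.
Qed.

(* Reflection in [a + x *+ 2] is the conjugate of reflection in [a] by
   reflection in [a + x], and the latter has no fixed point. *)
Lemma progression_avoidable a x :
  odd_elt (a + x) -> avoidable +%R [set a; a + x; a + x *+ 2].
Proof.
move=> /existsPn odd_ax; have [c cP] := pair_bicolouring a (a + x).
apply/(avoidableP _ _ _ G_gt1); exists c => y z neyz.
have sym_c u v : u != v -> u + v \in [set a; a + x] -> c u != c v.
  by move=> neuv /(cP u); rewrite addrAC subrr add0r; exact.
rewrite inE => /orP[|]; first exact: sym_c.
rewrite inE => /eqP yzE.
have flip w : c (a + x - w) = ~~ c w.
  have ne : w != a + x - w by rewrite eq_sym subr_eq -mulr2n eq_sym.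
  by have := cP w _ (set22 _ _) ne; case: (c w); case: (c _).
(* If [y + z] is [a + x *+ 2], the reflected points sum to [a], hence differ in colour; flipping
   both colours preserves this. *)
have := sym_c (a + x - y) (a + x - z).
rewrite !flip (inj_eq (can_inj (subKr _))) (inj_eq negb_inj); apply=> //.
rewrite !inE addrACA -opprD yzE; apply/orP; left.
by rewrite subr_eq mulr2n addrACA !addrA.
Qed.

(** The points [w - a], [w - b], [w - d] have pairwise sums [d], [b], [a], so they form a
    triangle. *)
Lemma triangle_not_avoidable U w a b d :
  avoidable +%R U -> a \in U -> b \in U -> d \in U ->
  a + b + d = w *+ 2 -> a != b -> b != d -> a != d -> False.
Proof.
move=> /(avoidableP _ _ _ G_gt1)[c cU] aU bU dU sumE neab nebd nead.
have sub_inj u v : u != v -> w - u != w - v.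
  by rewrite (inj_eq (can_inj (subKr _))).
have Ea : (w - b) + (w - d) = a.
  by rewrite addrACA -opprD -mulr2n -sumE -(addrA a) addrK.
have Eb : (w - a) + (w - d) = b.
  by rewrite addrACA -opprD -mulr2n -sumE (addrC a) -(addrA b) addrK.
have Ed : (w - a) + (w - b) = d.
  by rewrite addrACA -opprD -mulr2n -sumE addrC addKr.
have := cU _ _ (sub_inj _ _ neab); rewrite Ed => /(_ dU).
have := cU _ _ (sub_inj _ _ nebd); rewrite Ea => /(_ aU).
have := cU _ _ (sub_inj _ _ nead); rewrite Eb => /(_ bU).
by case: (c _); case: (c _); case: (c _).
Qed.

(* The closed walk [g + h - o, g + o - h, g + h, g - h, g + o + h] has odd
   length. *)
Lemma pentagon_not_avoidable U g h o :
  avoidable +%R U ->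
  g *+ 2 \in U -> g *+ 2 + h *+ 2 \in U -> g *+ 2 + o \in U ->
  odd_elt o -> h *+ 2 != 0 -> o *+ 2 != 0 -> h *+ 2 = o *+ 2.
Proof.
move=> /(avoidableP _ _ _ G_gt1)[c cU] aU bU oU /existsPn odd_o h2 o2.
apply/eqP/negPn/negP => neho.
have step u v : u != v -> g *+ 2 + (u + v) \in U -> c (g + u) = ~~ c (g + v).
  move=> neuv uvU; have := cU (g + u) (g + v).
  rewrite (inj_eq (addrI g)) addrACA -mulr2n => /(_ neuv uvU).
  by case: (c _); case: (c _).
(* Relative to [g], consecutive offsets sum to [0], [o], [0], [o], [h *+ 2]. Their distinctness
   comes from [neho], [odd_o], [h2], [odd_o], [o2] in turn. *)
have c1 : c (g + (h - o)) = ~~ c (g + (o - h)).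
  apply: step; last by rewrite subrKA subrr addr0.
  by rewrite -subr_eq0 opprB addrACA -mulr2n -opprD -mulr2n subr_eq0.
have c2 : c (g + (o - h)) = ~~ c (g + h).
  by apply: step; rewrite ?subrK // subr_eq -mulr2n eq_sym odd_o.
have c3 : c (g + h) = ~~ c (g - h).
  by apply: step; rewrite ?subrr ?addr0 // -subr_eq0 opprK -mulr2n.
have c4 : c (g - h) = ~~ c (g + (o + h)).
  apply: step; last by rewrite [- h + _]addrC addrK.
  apply: contra (odd_o (- h)) => /eqP e.
  by rewrite mulr2n {1}e addrK.
have c5 : c (g + (o + h)) = ~~ c (g + (h - o)).
  apply: step; last by rewrite [o + h]addrC (addrACA h o) subrr addr0 -mulr2n.
  by rewrite addrC (inj_eq (addrI h)) -subr_eq0 opprK -mulr2n.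
by move: c1; rewrite c2 c3 c4 c5; case: (c _).
Qed.

End AbelianGroup.

(** * Cyclic groups of even order, where parity of residues is additive *)

Section EvenOrder.

Variable m : nat.
Hypothesis odd_m : odd m.
Implicit Types (a b e o x y z : 'I_m.+1) (U V : {set 'I_m.+1}).

Let n_even : odd m.+1 = false. Proof. by rewrite /= odd_m. Qed.

Let n_gt1 : (1 < #|'I_m.+1|)%N. Proof. by rewrite card_ord ltnS odd_gt0. Qed.

Lemma odd_ordD x y : odd (x + y)%R = odd x (+) odd y.
Proof. by rewrite /= odd_mod // oddD. Qed.

Lemma odd_ordN x : odd (- x)%R = odd x.
Proof. by have := odd_ordD x (- x); rewrite subrr /=; case: odd; case: odd. Qed.

Lemma odd_ord_double x : odd (x *+ 2)%R = false.
Proof. by rewrite mulr2n odd_ordD addbb. Qed.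

Lemma even_eltE x : even_elt x = ~~ odd x.
Proof.
apply/existsP/idP => [[y /eqP <-]|]; first by rewrite odd_ord_double.
move=> even_x; exists (inZp x./2); rewrite Zp_mulrn; apply/eqP/val_inj => /=.
by rewrite modnMml muln2 halfK (negbTE even_x) subn0 modn_small.
Qed.

Lemma odd_eltE x : odd_elt x = odd x.
Proof. by rewrite /odd_elt even_eltE negbK. Qed.

Lemma even_eltB a b : even_elt a -> even_elt b -> exists y, b = a + y *+ 2.
Proof.
rewrite !even_eltE => ea eb; have /existsP[y /eqP yE] : even_elt (b - a).
  by rewrite even_eltE odd_ordD odd_ordN (negbTE ea) (negbTE eb).
by exists y; rewrite yE addrC subrK.
Qed.

(** Twice the representative is a multiple of [n] below [2n], so it is [0] or [n]. *)
Lemma ord_double_eq0 z : z *+ 2 = 0 -> z = 0 \/ z = inZp (m.+1 %/ 2).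
Proof.
rewrite Zp_mulrn => /(congr1 val) /= /eqP; rewrite -/(dvdn _ _) => /dvdnP[k].
have lt_zn := ltn_ord z.
case: k => [|[|k]] zE.
- by left; apply/val_inj/eqP; rewrite /= -(eqn_pmul2r (isT : 0 < 2)%N) zE.
- have -> : (m.+1 %/ 2 = z)%N by rewrite -[X in (X %/ _)%N]mul1n -zE mulnK.
  by right; rewrite valZpK.
- move: lt_zn; rewrite -(ltn_pmul2r (isT : 0 < 2)%N) zE ltnNge.
  by rewrite [X in (X <= _)%N]mulnC leq_mul2r.
Qed.

Lemma odd_residuesE : odd_residues m = [set x : 'I_m.+1 | odd_elt x].
Proof.
apply/setP=> x; rewrite inE odd_eltE; apply/imsetP/idP => [[l _ ->]|odd_x].
  by rewrite /= odd_mod // addn1 mul2n /= odd_double.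
(* Residue 1 is [2 * l + 1] for [l = n / 2], not for [l = 0]. *)
have [x1|x_neq1] := eqVneq (x : nat) 1%N.
  have half_lt : (m.+1 %/ 2 < m.+1)%N by rewrite ltn_Pdiv.
  exists (Ordinal half_lt); first by rewrite inE /= leqnn andbT divn_gt0 // ltnS odd_gt0.
  apply: val_inj; rewrite /= x1 mulnC divnK ?dvdn2 ?n_even //.
  by rewrite modnDl modn_small // ltnS odd_gt0.
have half_lt : (x %/ 2 < m.+1)%N by apply: leq_ltn_trans (ltn_ord x); exact: leq_div.
exists (Ordinal half_lt).
  rewrite inE; apply/andP; split; last by rewrite /= leq_div2r // ltnW.
  by rewrite divn_gt0 //; move: (x : nat) odd_x x_neq1 => [|[]].
have xE : x./2.*2.+1 = x by rewrite -[RHS]odd_double_half odd_x.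
by apply: val_inj; rewrite /= mulnC addn1 divn2 muln2 xE modn_small.
Qed.

(** Parity is a valid colouring: an odd sum has terms of opposite parity. *)
Lemma odds_avoidable : avoidable +%R [set x : 'I_m.+1 | odd_elt x].
Proof.
apply/(avoidableP _ _ _ n_gt1); exists (fun x => odd x) => x y _.
by rewrite inE odd_eltE odd_ordD; case: odd; case: odd.
Qed.

Lemma avoidable_odd_sum U a b d :
  avoidable +%R U -> a \in U -> b \in U -> d \in U ->
  a != b -> b != d -> a != d -> odd a (+) odd b (+) odd d.
Proof.
move=> avU aU bU dU ab bd ad; rewrite -!odd_ordD -odd_eltE.
apply/existsP=> -[w /eqP wE].
exact: (triangle_not_avoidable _ n_gt1 _ w _ _ _ avU aU bU dU (esym wE) ab bd ad).
Qed.

(** The pentagon is used with [g *+ 2 = a], [h *+ 2 = b - a] and odd offset [o - a]. *)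
Lemma avoidable_midpoint U a b o :
  avoidable +%R U -> a \in U -> b \in U -> o \in U ->
  a != b -> ~~ odd a -> ~~ odd b -> odd o -> a + b = o *+ 2.
Proof.
(* If [o - a] has zero double, exchange [a] and [b]. If [o - b] has zero double as well, both
   differences are [n/2], forcing [a = b]. *)
wlog ao2 : a b / (o - a) *+ 2 != 0.
  move=> IH avU aU bU oU neab ea eb oo.
  have [a2|] := eqVneq ((o - a) *+ 2) 0; last by move=> a2; apply: IH.
  have [b2|] := eqVneq ((o - b) *+ 2) 0; last first.
    by move=> b2; rewrite addrC; apply: IH; rewrite // eq_sym.
  have half e : ~~ odd e -> (o - e) *+ 2 = 0 -> o - e = inZp (m.+1 %/ 2).
    move=> ee /ord_double_eq0[] // /eqP; rewrite subr_eq0 => /eqP oe.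
    by rewrite -oe oo in ee.
  case/eqP: neab; apply: (can_inj (subKr o)).
  by rewrite (half a) // (half b).
move=> avU aU bU oU neab ea eb oo.
have /existsP[g /eqP gE] : even_elt a by rewrite even_eltE.
have /existsP[h /eqP hE] : even_elt (b - a).
  by rewrite even_eltE odd_ordD odd_ordN (negbTE ea) (negbTE eb).
have := pentagon_not_avoidable _ n_gt1 _ g h (o - a) avU.
rewrite gE hE !(addrC a) !subrK odd_eltE odd_ordD odd_ordN oo (negbTE ea).
rewrite subr_eq0 eq_sym => /(_ aU bU oU isT neab ao2) /eqP.
rewrite mulrnBl subr_eq => /eqP ->.
by rewrite mulr2n [a *+ 2]mulr2n opprD !addrA !subrK.
Qed.

(** The split is by the parities occurring in [U]. Next to an even [e] and an odd [o], a third
    element must be even by the triangle and then equal [o *+ 2 - e] by the midpoint lemma; three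
    even elements would have an even sum. *)
Lemma avoidable_cases U : avoidable +%R U ->
  [\/ U \subset [set x | odd_elt x],
      exists a x, [/\ even_elt a, odd_elt x & U \subset [set a; a + x; a + x *+ 2]]
    | exists a b, [/\ even_elt a, even_elt b, a != b & U = [set a; b]]].
Proof.
move=> avU.
have [/existsP[e /andP[eU even_e]]|/existsPn noeven] :=
  boolP [exists e, (e \in U) && ~~ odd e]; last first.
  apply: Or31; apply/subsetP => x xU; rewrite inE odd_eltE.
  by have := noeven x; rewrite xU negbK.
have [/existsP[o /andP[oU odd_o]]|/existsPn noodd] :=
  boolP [exists o, (o \in U) && odd o].
  apply: Or32; exists e, (o - e).
  rewrite even_eltE odd_eltE odd_ordD odd_ordN odd_o (negbTE even_e).
  split=> //; apply/subsetP => x xU.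
  rewrite !inE addrC subrK.
  have [//|nexe] := eqVneq x e; have [//|nexo] := eqVneq x o.
  have neeo : e != o by apply: contraNneq even_e => ->.
  have := avoidable_odd_sum _ _ _ _ avU eU oU xU neeo.
  rewrite eq_sym nexo eq_sym nexe odd_o (negbTE even_e) => /(_ isT isT) /= even_x.
  have := avoidable_midpoint _ _ _ _ avU eU xU oU.
  rewrite eq_sym => /(_ nexe even_e even_x odd_o) exE.
  by rewrite mulrnBl -exE mulr2n !addrA addrAC subrr add0r.
have even_U x : x \in U -> ~~ odd x by move=> xU; have := noodd x; rewrite xU.
have [/existsP[e' /andP[e'U nee]]|/existsPn only_e] :=
  boolP [exists e', (e' \in U) && (e' != e)].
  apply: Or33; exists e, e'; rewrite !even_eltE !even_U // eq_sym; split=> //.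
  apply/setP=> x; rewrite !inE; apply/idP/orP => [xU|[]/eqP-> //].
  have [xe|nexe] := eqVneq x e; first by left.
  have [xe'|nexe'] := eqVneq x e'; first by right.
  have := avoidable_odd_sum _ _ _ _ avU xU eU e'U nexe.
  by rewrite eq_sym nee nexe' !(negbTE (even_U _ _)) // => /(_ isT isT).
(* A lone even element lies in every progression starting at it; the odd step 1 is an arbitrary
   choice. *)
apply: Or32; exists e, (inZp 1).
rewrite even_eltE odd_eltE even_U //= odd_mod //; split=> //.
apply/subsetP => x xU; rewrite !inE.
by have := only_e x; rewrite xU negbK => ->.
Qed.

(** Every avoidable set lies in one of three avoidable shapes, so maximality reduces to inclusions
    between shapes. A progression absorbs an even pair whose difference is twice an odd element, and
    absorbs the set of odd elements only if [n = 2]. *)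
Lemma saturated_even_order U : saturated +%R U <->
  [\/ exists a x, [/\ even_elt a, odd_elt x & U = [set a; a + x; a + x *+ 2]],
      exists a b, [/\ even_elt a, even_elt b, a != b,
                      (forall x, odd_elt x -> b <> a + x *+ 2) & U = [set a; b]]
    | (2 < m.+1)%N /\ U = [set x | odd_elt x]].
Proof.
have progE a x : even_elt a -> odd_elt x -> avoidable +%R [set a; a + x; a + x *+ 2].
  rewrite even_eltE odd_eltE => ea ox; apply: progression_avoidable n_gt1 _ _ _.
  by rewrite odd_eltE odd_ordD ox (negbTE ea).
have odd_in_prog c y z : even_elt c -> odd z -> z \in [set c; c + y; c + y *+ 2] -> z = c + y.
  rewrite even_eltE !inE => ec oz /orP[/orP[]|] /eqP // zE.
    by rewrite -zE oz in ec.
  by move: oz; rewrite zE odd_ordD odd_ord_double (negbTE ec).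
have even_in_prog c y z : even_elt c -> odd_elt y -> ~~ odd z ->
    z \in [set c; c + y; c + y *+ 2] -> z = c \/ z = c + y *+ 2.
  rewrite even_eltE odd_eltE !inE => ec oy ez /orP[/orP[]|] /eqP zE; [by left| |by right].
  by move: ez; rewrite zE odd_ordD (negbTE ec) oy.
split=> [/maxsetP[avU maxU]|].
  case: (avoidable_cases U avU) => [odd_U|[a [x [ea ox sub]]]|[a [b [ea eb neab UE]]]].
  - apply: Or33; have UE := maxU _ odds_avoidable odd_U; split=> //.
    rewrite ltnNge; apply/negP=> n_le2.
    have o1 : odd_elt (inZp 1 : 'I_m.+1) by rewrite odd_eltE /= odd_mod.
    have e0 : even_elt (0 : 'I_m.+1) by rewrite even_eltE.
    have : 0 \in U.
      rewrite -(maxU _ (progE 0 (inZp 1) e0 o1)) ?inE ?eqxx //.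
      apply/subsetP=> x; rewrite -UE !inE odd_eltE => ox; rewrite add0r.
      suff -> : x = inZp 1 by rewrite eqxx orbT.
      have x1 : x = 1%N :> nat.
        by move: (leq_trans (ltn_ord x) n_le2) ox; case: (x : nat) => [|[|]].
      by apply: val_inj; rewrite /= x1 modn_small // ltnS odd_gt0.
    by rewrite -UE inE odd_eltE.
  - by apply: Or31; exists a, x; split=> //; rewrite (maxU _ (progE _ _ ea ox)).
  (* For odd [x] the pair would be the ends of a progression, and maximality would put its odd
     middle term in [U]. *)
  - apply: Or32; exists a, b; split=> // x ox bE.
    have sub : U \subset [set a; a + x; a + x *+ 2].
      by apply/subsetP=> z; rewrite UE bE !inE => /orP[]->; rewrite ?orbT.
    have : a + x \in U by rewrite -(maxU _ (progE _ _ ea ox) sub) !inE eqxx orbT.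
    move: ea eb ox; rewrite UE !even_eltE odd_eltE !inE => ea eb ox.
    have : odd (a + x)%R by rewrite odd_ordD ox (negbTE ea).
    by move=> /[swap] /orP[]/eqP->; rewrite ?(negbTE ea) ?(negbTE eb).
case=> [[a [x [ea ox ->]]]|[a [b [ea eb neab nodd ->]]]|[n_gt2 ->]];
  apply/maxsetP; split.
- exact: progE.
- move=> V avV sub; apply/eqP; rewrite eqEsubset sub andbT.
  have aV : a \in V by apply: (subsetP sub); rewrite !inE eqxx.
  have axV : a + x \in V by apply: (subsetP sub); rewrite !inE eqxx orbT.
  have even_a : ~~ odd a by rewrite -even_eltE.
  have odd_ax : odd (a + x)%R by rewrite odd_ordD -(odd_eltE x) ox (negbTE even_a).
  case: (avoidable_cases V avV) => [/subsetP odd_V|[c [y [ec oy subV]]]|[c [d [ec ed _ VE]]]].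
  + by have := odd_V a aV; rewrite inE /odd_elt ea.
  + apply: (subset_trans subV).
    have := odd_in_prog c y _ ec odd_ax (subsetP subV _ axV).
    (* The odd middle terms coincide, so [a] is one of the two ends; if it is the last one, the same
       progression is read backwards. *)
    case: (even_in_prog c y a ec oy even_a (subsetP subV _ aV)) => [<- /addrI -> //|aE].
    rewrite aE -addrA -[X in _ = c + X]addr0 mulr2n -addrA => /addrI/addrI/eqP.
    rewrite addr_eq0 => /eqP yE; rewrite {}yE.
    apply/subsetP=> z; rewrite !inE !mulr2n !addrA !subrK.
    by case/orP=> [/orP[]|] ->; rewrite ?orbT.
  + move: axV ec ed; rewrite VE !inE !even_eltE => /orP[]/eqP <-; by rewrite odd_ax.
- exact: pair_avoidable.
- move=> V avV sub; apply/eqP; rewrite eqEsubset sub andbT.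
  have aV : a \in V by apply: (subsetP sub); rewrite !inE eqxx.
  have bV : b \in V by apply: (subsetP sub); rewrite !inE eqxx orbT.
  have even_a : ~~ odd a by rewrite -even_eltE.
  have even_b : ~~ odd b by rewrite -even_eltE.
  case: (avoidable_cases V avV) => [/subsetP odd_V|[c [y [ec oy subV]]]|[c [d [ec ed _ VE]]]].
  + by have := odd_V a aV; rewrite inE /odd_elt ea.
  + case: (even_in_prog c y a ec oy even_a (subsetP subV _ aV)) => aE;
      case: (even_in_prog c y b ec oy even_b (subsetP subV _ bV)) => bE.
    * by rewrite aE bE eqxx in neab.
    * by case: (nodd y oy); rewrite bE aE.
    (* Here the pair occurs in reverse order, and the odd step is [- y]. *)
    * case: (nodd (- y)); first by rewrite odd_eltE odd_ordN -odd_eltE.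
      by rewrite bE aE mulNrn addrK.
    * by rewrite aE bE eqxx in neab.
  + move: aV bV neab; rewrite VE !inE => /orP[]/eqP -> /orP[]/eqP ->; rewrite ?eqxx // => _.
    by apply/subsetP=> z; rewrite !inE orbC.
- exact: odds_avoidable.
- move=> V avV sub; apply/eqP; rewrite eqEsubset sub andbT.
  (* An even [n] above 2 is at least 4, so 1 and 3 are distinct odd residues; a progression of the
     above kind has a single odd term and an even pair has none. *)
  have small j : (j <= 3)%N -> (j %% m.+1 = j)%N.
    move=> j3; apply: modn_small; rewrite ltnS (leq_trans j3) //.
    by move: n_gt2 odd_m; rewrite ltnS; case: (m) => [|[|[|]]].
  have oV j : (j <= 3)%N -> odd j -> inZp j \in V.
    by move=> j3 oj; apply: (subsetP sub); rewrite inE odd_eltE /= small.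
  have o1 : odd (inZp 1 : 'I_m.+1) by rewrite /= small.
  have o3 : odd (inZp 3 : 'I_m.+1) by rewrite /= small.
  case: (avoidable_cases V avV) => [//|[c [y [ec oy subV]]]|[c [d [ec ed _ VE]]]].
  + have := odd_in_prog c y _ ec o1 (subsetP subV _ (oV 1%N isT isT)).
    rewrite -(odd_in_prog c y _ ec o3 (subsetP subV _ (oV 3%N isT isT))).
    by move/(congr1 val); rewrite /= !small.
  + have := oV 1%N isT isT; rewrite VE !inE => /orP[]/eqP cE.
      by move: ec; rewrite -cE even_eltE o1.
    by move: ed; rewrite -cE even_eltE o1.
Qed.

Lemma half_order_double : (inZp (m.+1 %/ 2) : 'I_m.+1) *+ 2 = 0.
Proof.
by rewrite Zp_mulrn; apply: val_inj; rewrite /= modnMml divnK ?modnn // dvdn2 n_even.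
Qed.

End EvenOrder.

(** * Cyclic groups of odd order *)

Section OddOrder.

Variable m : nat.
Hypothesis even_m : ~~ odd m.
Implicit Types (a b d : 'I_m.+1) (U V : {set 'I_m.+1}).

Lemma odd_order_half a : exists w, a = w *+ 2.
Proof.
(* [m./2.+1] is [(n + 1)/2], the inverse of 2 modulo [n]. *)
exists (inZp (a * m./2.+1)); rewrite Zp_mulrn; apply: val_inj => /=.
rewrite modnMml -mulnA muln2 doubleS halfK (negbTE even_m) subn0.
by rewrite mulnS addnC modnMDl modn_small.
Qed.

(** Every element is a double, so any three distinct elements produce a triangle. *)
Lemma avoidable_odd_order U a b : avoidable +%R U -> a != b ->
  a \in U -> b \in U -> U = [set a; b].
Proof.
move=> avU neab aU bU; apply/setP=> d; rewrite !inE.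
apply/idP/orP=> [dU|[]/eqP-> //].
have [da|neda] := eqVneq d a; first by left.
have [db|nedb] := eqVneq d b; first by right.
have [w wE] := odd_order_half (a + b + d).
have n_gt1 : (1 < #|'I_m.+1|)%N by apply/card_gt1P; exists a, b.
rewrite eq_sym in neda; rewrite eq_sym in nedb.
by case: (triangle_not_avoidable _ n_gt1 _ w _ _ _ avU aU bU dU wE neab nedb neda).
Qed.

Lemma saturated_odd_order U :
  saturated +%R U <-> exists a b, a != b /\ U = [set a; b].
Proof.
split=> [/maxsetP[avU maxU]|[a [b [neab ->]]]].
  have n_gt1 : (1 < #|'I_m.+1|)%N by exact: avoidable_card_gt1 avU.
  suff [a [b [neab sub]]] : exists a b, a != b /\ U \subset [set a; b].
    by exists a, b; rewrite -(maxU _ (pair_avoidable _ n_gt1 a b) sub).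
  have [/card_gt1P[a [b [aU bU neab]]]|/card_le1_eqP U_le1] := ltnP 1 #|U|.
    by exists a, b; rewrite neab -(avoidable_odd_order U).
  have [a sub] : exists a, U \subset [set a].
    have [->|[a aU]] := set_0Vmem U; first by exists 0; rewrite sub0set.
    by exists a; apply/subsetP=> x xU; rewrite inE (U_le1 a x).
  (* A set with at most one element is enlarged to a pair, as [n > 1]. *)
  have /card_gt0P[b] : (0 < #|[set~ a]|)%N by rewrite cardsC1 -subn1 subn_gt0.
  rewrite !inE eq_sym => neab; exists a, b; split=> //.
  exact: subset_trans sub (subsetUl _ _).
have n_gt1 : (1 < #|'I_m.+1|)%N by apply/card_gt1P; exists a, b.
apply/maxsetP; split=> [|V avV sub]; first exact: pair_avoidable.
by apply: avoidable_odd_order; rewrite // (subsetP sub) // !inE eqxx ?orbT.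
Qed.

End OddOrder.

(** * The classification by the residue of [n] modulo 4 *)

Theorem theorem2p3 (m : nat) :
  (* (a) *)
  (forall k : nat, m.+1 = (2 * k + 1)%N ->
    forall U : {set 'I_m.+1}, saturated +%R U <->
      (exists a b : 'I_m.+1, a != b /\ U = [set a; b])) /\
  (* (b) *)
  (forall k : nat, m.+1 = (4 * k + 2)%N ->
    odd_residues m = [set x : 'I_m.+1 | odd_elt x] /\
    forall U : {set 'I_m.+1}, saturated +%R U <->
      [\/ exists a x : 'I_m.+1,
            [/\ odd_elt x, x != inZp (m.+1 %/ 2), even_elt a
              & U = [set a; a + x; a + x *+ 2]],
          exists a : 'I_m.+1, U = [set a; a + inZp (m.+1 %/ 2)]
        | (0 < k)%N /\ U = odd_residues m]) /\
  (* (c) *)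
  (forall k : nat, m.+1 = (4 * k)%N ->
    odd_residues m = [set x : 'I_m.+1 | odd_elt x] /\
    forall U : {set 'I_m.+1}, saturated +%R U <->
      [\/ exists a x : 'I_m.+1,
            [/\ odd_elt x, even_elt a & U = [set a; a + x; a + x *+ 2]],
          exists a x : 'I_m.+1,
            [/\ even_elt a, x != inZp (m.+1 %/ 4), x *+ 4 != 0
              & U = [set a; a + x *+ 4]]
        | U = odd_residues m]).
Proof.
split; [|split] => k nE.
- apply: saturated_odd_order.
  by have := congr1 odd nE; rewrite addn1 mul2n /= odd_double /= => ->.
- have odd_m : odd m.
    by have := congr1 odd nE; rewrite oddD oddM /= => /negbFE.
  have half_nE : (m.+1 %/ 2 = 2 * k + 1)%N.
    by rewrite nE (_ : 4 * k + 2 = (2 * k + 1) * 2)%N ?mulnK // mulnDl mulnAC.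
  set h : 'I_m.+1 := inZp (m.+1 %/ 2).
  (* As [n/2 = 2k + 1], the element [h] is odd and has order two, so progressions of step [h]
     collapse to pairs. *)
  have odd_h : odd h.
    by rewrite /= odd_mod /= ?odd_m // half_nE oddD oddM.
  have h2 : h *+ 2 = 0 by exact: half_order_double.
  have progh a : [set a; a + h; a + h *+ 2] = [set a; a + h].
    by apply/setP=> z; rewrite h2 addr0 !inE orbAC orbb.
  split; first exact: odd_residuesE.
  move=> U; split=> [/(saturated_even_order m odd_m)|].
    case=> [[a [x [ea ox UE]]]|[a [b [ea eb neab nodd UE]]]|[n_gt2 UE]].
    + have [xh|nexh] := eqVneq x h; last by apply: Or31; exists a, x.
      by apply: Or32; exists a; rewrite UE xh progh.
    (* No even pair is saturated here: [y] and [y + h] have the same double and opposite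
       parities. *)
    + have [y bE] := even_eltB _ odd_m _ _ ea eb.
      have [oy|ey] := boolP (odd y); first by case: (nodd y); rewrite ?odd_eltE.
      case: (nodd (y + h)); last by rewrite mulrnDl h2 addr0.
      by rewrite odd_eltE // odd_ordD // odd_h (negbTE ey).
    + apply: Or33; rewrite odd_residuesE //; split=> //.
      by move: n_gt2; rewrite nE; case: (k).
  case=> [[a [x [ox _ ea UE]]]|[a UE]|[k_gt0 UE]];
    apply/(saturated_even_order m odd_m).
  + by apply: Or31; exists a, x.
  + apply: Or31; rewrite UE.
    have oh : odd_elt h by rewrite odd_eltE.
    (* Of [a] and [a + h] exactly one is even, and the collapsed progression starts there. *)
    have [oa|ea] := boolP (odd a); last by exists a, h; rewrite even_eltE // progh.
    exists (a + h), h; rewrite even_eltE // odd_ordD // oa odd_h progh; split=> //.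
    by rewrite -addrA -mulr2n h2 addr0 setUC.
  + apply: Or33; rewrite UE odd_residuesE //; split=> //.
    by rewrite nE; case: (k) k_gt0 => // j _; rewrite addn2 !ltnS.
- have odd_m : odd m.
    by have := congr1 odd nE; rewrite oddM /= => /negbFE.
  have half_nE : (m.+1 %/ 2 = 2 * k)%N.
    by rewrite nE (_ : 4 * k = (2 * k) * 2)%N ?mulnK // mulnAC.
  split; first exact: odd_residuesE.
  move=> U; split=> [/(saturated_even_order m odd_m)|].
    case=> [[a [x [ea ox UE]]]|[a [b [ea eb neab nodd UE]]]|[n_gt2 UE]].
    + by apply: Or31; exists a, x.
    (* An odd [y] would make the pair the ends of a progression, so [y] is itself a double and the
       difference is a multiple of 4. *)
    + have [y bE] := even_eltB _ odd_m _ _ ea eb.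
      have /existsP[x /eqP xE] : even_elt y.
        rewrite even_eltE //; apply/negP=> oy.
        by case: (nodd y); rewrite ?odd_eltE.
      have {}bE : b = a + x *+ 4 by rewrite bE -xE -mulrnA.
      have x4 : x *+ 4 != 0 by apply: contraNneq neab => x40; rewrite bE x40 addr0.
      apply: Or32; exists a, x; rewrite -bE; split=> //.
      (* At [x = n/4] the element [x *+ 4] would be zero. *)
      apply: contraNneq x4 => ->; rewrite Zp_mulrn; apply/eqP/val_inj.
      by rewrite /= modnMml nE mulKn // mulnC modnn.
    + by apply: Or33; rewrite odd_residuesE.
  case=> [[a [x [ox ea UE]]]|[a [x [ea _ x4 UE]]]|UE];
    apply/(saturated_even_order m odd_m).
  + by apply: Or31; exists a, x.
  + have even_dd (z : 'I_m.+1) : odd (z *+ 4)%R = false.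
      by rewrite (mulrnA z 2 2) odd_ord_double.
    apply: Or32; exists a, (a + x *+ 4); split=> //.
    * move: ea; rewrite !(even_eltE _ odd_m) odd_ordD // => /negbTE ->.
      by rewrite even_dd.
    * by rewrite -subr_eq0 opprD addrA subrr add0r oppr_eq0.
    (* If [z] is odd with [z *+ 2 = x *+ 4], then [x *+ 2 - z] is odd with zero double; but [0] and
       [n/2 = 2k] are both even. *)
    move=> z; rewrite odd_eltE // => oz /addrI.
    rewrite (mulrnA x 2 2) => /eqP; rewrite -subr_eq0 -mulrnBl => /eqP.
    have even_dz : odd (x *+ 2 - z)%R by rewrite odd_ordD // odd_ordN // oz odd_ord_double.
    case/(ord_double_eq0 m) => zE; move: even_dz; rewrite zE //=.
    by rewrite odd_mod /= ?odd_m // half_nE oddM.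
  + apply: Or33; rewrite UE odd_residuesE //; split=> //.
    by case: (k) nE => // j ->; rewrite mulnS.
Qed.
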